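(* For all integers $p,q\ge 0$ with $p+q\ge 3$, the cubic forms $\alpha_{p,q}$ and $\tilde\alpha_{p,q}$ on $\mathbb{Z}_2^{p+q}$ are equivalent.
   Context: $\mathbb{Z}_2$ is the field with two elements. A cubic form on $\mathbb{Z}_2^n$ is a function $\mathbb{Z}_2^n\to\mathbb{Z}_2$ given by a polynomial of degree $\le 3$ without constant term. Two cubic forms $\alpha,\alpha'$ on $\mathbb{Z}_2^n$ are equivalent if there is $G\in\mathrm{GL}_n(\mathbb{Z}_2)$ with $\alpha(x)=\alpha'(Gx)$ for all $x$. For $p+q=n$, $$\alpha_{p,q}(x)=\sum_{1\le i<j<k\le n}x_ix_jx_k+\sum_{1\le i<j\le n}x_ix_j+\sum_{1\le i\le n}x_i+\sum_{1\le i\le p}x_i .$$ The forms $\tilde\alpha_{p,q}$ ($p+q=n\ge3$, variables $x_1,\dots,x_n$) are defined as follows. (A) Signature $(0,n)$: $\tilde\alpha_{0,3}=x_1x_2x_3+x_1x_2+x_1x_3+x_2x_3+x_1+x_2+x_3$; $\tilde\alpha_{0,4}=x_1x_3x_4+x_1x_3+x_1x_4+x_3x_4+x_1+x_3+x_4$; $\tilde\alpha_{0,5}=x_1x_2x_3+x_1x_4x_5+x_2x_3+x_1x_4+x_1x_5+x_4x_5+x_1+x_4+x_5$; $\tilde\alpha_{0,6}=x_1x_3x_4+x_1x_5x_6+x_1x_2+x_3x_4+x_1x_5+x_1x_6+x_5x_6+x_1+x_2+x_5+x_6$; and in general $\tilde\alpha_{0,4k+3}(x_1,\dots,x_{4k+3})=\tilde\alpha_{0,3}(x_1,x_2,x_3)+\sum_{i=1}^{k}\big(x_1+\tilde\alpha_{0,5}(x_1,x_{4i},\dots,x_{4i+3})\big)$;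 $\tilde\alpha_{0,4k}(x_1,\dots,x_{4k})=\tilde\alpha_{0,4}(x_1,\dots,x_4)+\sum_{i=1}^{k-1}\big(x_1+\tilde\alpha_{0,5}(x_1,x_{4i+1},\dots,x_{4i+4})\big)$; $\tilde\alpha_{0,4k+1}(x_1,\dots,x_{4k+1})=\tilde\alpha_{0,5}(x_1,\dots,x_5)+\sum_{i=1}^{k-1}\big(x_1+\tilde\alpha_{0,5}(x_1,x_{4i+2},\dots,x_{4i+5})\big)$; $\tilde\alpha_{0,4k+2}(x_1,\dots,x_{4k+2})=\tilde\alpha_{0,6}(x_1,\dots,x_6)+\sum_{i=1}^{k-1}\big(x_1+\tilde\alpha_{0,5}(x_1,x_{4i+3},\dots,x_{4i+6})\big)$. (B) Signature $(n,0)$: $\tilde\alpha_{n,0}(x_1,\dots,x_n)=\tilde\alpha_{0,n}(x_1,\dots,x_n)+x_1$. (C) Signature $(p,q)$ with $p,q>0$. Eleven initial cases: $\tilde\alpha_{1,2}=x_1x_2x_3+x_1x_2+x_1x_3+x_2x_3+x_1$; $\tilde\alpha_{2,2}=x_1x_3x_4+x_1x_3+x_1x_4+x_3x_4+x_1$; $\tilde\alpha_{1,3}=x_1x_3x_4+x_1x_3+x_1x_4+x_3x_4+x_1+x_2+x_4$; $\tilde\alpha_{2,3}=x_1x_2x_3+x_1x_4x_5+x_2x_3+x_1x_4+x_1x_5+x_4x_5+x_1$; $\tilde\alpha_{1,4}=x_1x_2x_3+x_1x_4x_5+x_2x_3+x_1x_4+x_1x_5+x_4x_5+x_1+x_2+x_3$;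 $\tilde\alpha_{3,3}=x_1x_3x_4+x_1x_5x_6+x_1x_2+x_3x_4+x_1x_5+x_1x_6+x_5x_6+x_1$; $\tilde\alpha_{2,4}=x_1x_3x_4+x_1x_5x_6+x_1x_2+x_3x_4+x_1x_5+x_1x_6+x_5x_6+x_1+x_2+x_3+x_4$; $\tilde\alpha_{1,5}=x_1x_3x_4+x_1x_5x_6+x_1x_2+x_3x_4+x_1x_5+x_1x_6+x_5x_6+x_1+x_5+x_6$; $\tilde\alpha_{2,5}=x_1x_2x_3+x_1x_4x_5+x_1x_6x_7+x_1x_2+x_1x_3+x_2x_3+x_4x_5+x_1x_6+x_1x_7+x_6x_7+x_1+x_6+x_7$; $\tilde\alpha_{2,6}=x_1x_3x_4+x_1x_5x_6+x_1x_7x_8+x_1x_3+x_1x_4+x_3x_4+x_5x_6+x_1x_7+x_1x_8+x_7x_8+x_1+x_7+x_8$; $\tilde\alpha_{3,6}=x_1x_2x_3+x_1x_4x_5+x_1x_6x_7+x_1x_8x_9+x_2x_3+x_4x_5+x_1x_6+x_1x_7+x_6x_7+x_1x_8+x_1x_9+x_8x_9+x_1+x_8+x_9$. The remaining forms with $p,q>0$ are determined by the rules $\tilde\alpha_{q,p}:=\tilde\alpha_{p,q}$; $\ \tilde\alpha_{p,q+4}:=\tilde\alpha_{p+4,q}$; and, for $n=p+q\geq 3$ and $(p,q)\ne(1,4),(4,1)$, $\tilde\alpha_{p+2,q+2}(x_1,\dots,x_{n+4}):=\tilde\alpha_{p,q}(x_1,\dots,x_n)+\tilde\alpha_{2,3}(x_1,x_{n+1},x_{n+2},x_{n+3},x_{n+4})+x_1$.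 *)

(* Defs.v *)
From HB Require Import structures.
From mathcomp Require Import all_boot all_order all_algebra.
From mathcomp Require Import zify.
From mathcomp Require Import mpoly.

Set Implicit Arguments.
Unset Strict Implicit.
Unset Printing Implicit Defensive.

Import GRing.Theory.
Local Open Scope ring_scope.

(* ** Cubic forms on F_2^n and their equivalence *)

Definition is_cubic n (f : 'cV['F_2]_n -> 'F_2) : Prop :=
  exists P : {mpoly 'F_2[n]},
    [/\ (msize P <= 4)%N (* total degree at most 3 *),
        P@_0%MM = 0
      & forall v, f v = P.@[fun i => v i 0]].

Record cubic_form n := CubicForm {
  cubic_fun :> 'cV['F_2]_n -> 'F_2;
  cubic_funP : is_cubic cubic_fun
}.

Definition cubic_equiv n (a b : cubic_form n) : Prop :=
  exists2 G : 'M['F_2]_n, G \in unitmx & forall v, a v = b (G *m v).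

(* [var v k] is the coordinate x_k of v, numbered from 1; it is 0 when k is
   not in 1..n. *)
Definition var n (v : 'cV['F_2]_n) (k : nat) : 'F_2 :=
  if k is k'.+1 then oapp (fun i : 'I_n => v i 0) 0 (insub k') else 0.

Lemma is_cubic_ext n (f g : 'cV['F_2]_n -> 'F_2) :
  f =1 g -> is_cubic f -> is_cubic g.
Proof. by move=> fg [P [sP P0 fP]]; exists P; split=> // v; rewrite -fg. Qed.

Lemma is_cubic0 n : is_cubic (fun _ : 'cV['F_2]_n => 0).
Proof.
by exists 0; split=> [||v]; rewrite ?msize0 ?mcoeff0 ?meval0.
Qed.

Lemma is_cubicD n (f g : 'cV['F_2]_n -> 'F_2) :
  is_cubic f -> is_cubic g -> is_cubic (fun v => f v + g v).
Proof.
case=> [P [sP P0 fP]] [Q [sQ Q0 gQ]]; exists (P + Q); split=> [||v].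
- by apply: leq_trans (msizeD_le _ _) _; rewrite geq_max sP.
- by rewrite mcoeffD P0 Q0 addr0.
- by rewrite mevalD fP gQ.
Qed.

Lemma is_cubic_sum n (I : Type) (r : seq I) (p : pred I)
    (F : I -> 'cV['F_2]_n -> 'F_2) :
  (forall i, is_cubic (F i)) ->
  is_cubic (fun v => \sum_(i <- r | p i) F i v).
Proof.
move=> FP; elim: r => [|i r IHr].
  by apply: is_cubic_ext (is_cubic0 n) => v; rewrite big_nil.
case pi: (p i); last by apply: is_cubic_ext IHr => v; rewrite big_cons pi.
by apply: is_cubic_ext (is_cubicD (FP i) IHr) => v; rewrite big_cons pi.
Qed.

Lemma is_cubic_coord1 n (i : 'I_n) : is_cubic (fun v => v i 0).
Proof.
exists 'X_i; split=> [||v]; first by rewrite msizeX mdeg1.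
  by rewrite mcoeffX mnm1_eq0.
by rewrite mevalXU.
Qed.

Lemma is_cubic_coord2 n (i j : 'I_n) : is_cubic (fun v => v i 0 * v j 0).
Proof.
exists ('X_i * 'X_j); split=> [||v].
- by rewrite -mpolyXD msizeX mdegD !mdeg1.
- by rewrite -mpolyXD mcoeffX mnmD_eq0 mnm1_eq0.
- by rewrite mevalM !mevalXU.
Qed.

Lemma is_cubic_coord3 n (i j k : 'I_n) :
  is_cubic (fun v => v i 0 * v j 0 * v k 0).
Proof.
exists ('X_i * 'X_j * 'X_k); split=> [||v].
- by rewrite -!mpolyXD msizeX !mdegD !mdeg1.
- by rewrite -!mpolyXD mcoeffX !mnmD_eq0 mnm1_eq0.
- by rewrite !mevalM !mevalXU.
Qed.

Variant var_spec n k : ('cV['F_2]_n -> 'F_2) -> Prop :=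
  | VarCoord (i : 'I_n) of k = i.+1 : var_spec k (fun v => v i 0)
  | VarOut : var_spec k (fun _ => 0).

Lemma varP n k : exists2 f : 'cV['F_2]_n -> 'F_2,
  var_spec k f & forall v, var v k = f v.
Proof.
case: k => [|k]; first by exists (fun _ => 0) => //; constructor.
rewrite /var; case: insubP => [i _ ki|_] /=.
  by exists (fun v => v i 0) => //; constructor; rewrite -ki.
by exists (fun _ => 0) => //; constructor.
Qed.

Lemma is_cubic_var1 n k : is_cubic (fun v : 'cV['F_2]_n => var v k).
Proof.
have [f [i _|] fE] := varP n k; apply: (is_cubic_ext (fsym fE)).
  exact: is_cubic_coord1.
exact: is_cubic0.
Qed.

Lemma is_cubic_var2 n k l :
  is_cubic (fun v : 'cV['F_2]_n => var v k * var v l).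
Proof.
have [f fP fE] := varP n k; have [g gP gE] := varP n l.
have fgE v : f v * g v = var v k * var v l by rewrite fE gE.
apply: (is_cubic_ext fgE); case: fP => [i _|]; last first.
  by apply: is_cubic_ext (is_cubic0 n) => v; rewrite mul0r.
case: gP => [j _|]; first exact: is_cubic_coord2.
by apply: is_cubic_ext (is_cubic0 n) => v; rewrite mulr0.
Qed.

Lemma is_cubic_var3 n k l m :
  is_cubic (fun v : 'cV['F_2]_n => var v k * var v l * var v m).
Proof.
have [f fP fE] := varP n k; have [g gP gE] := varP n l.
have [h hP hE] := varP n m.
have fghE v : f v * g v * h v = var v k * var v l * var v m.
  by rewrite fE gE hE.
apply: (is_cubic_ext fghE); case: fP => [i _|]; last first.
  by apply: is_cubic_ext (is_cubic0 n) => v; rewrite !mul0r.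
case: gP => [j _|]; last first.
  by apply: is_cubic_ext (is_cubic0 n) => v; rewrite mulr0 mul0r.
case: hP => [r _|]; first exact: is_cubic_coord3.
by apply: is_cubic_ext (is_cubic0 n) => v; rewrite mulr0.
Qed.

Arguments var : simpl never.

Ltac solve_cubic := repeat lazymatch goal with
  | |- is_cubic (fun v => @?f v + @?g v) => apply: is_cubicD
  | |- is_cubic (fun v => var v _ * var v _ * var v _) => exact: is_cubic_var3
  | |- is_cubic (fun v => var v _ * var v _) => exact: is_cubic_var2
  | |- is_cubic (fun v => var v _) => exact: is_cubic_var1
  | |- is_cubic (fun v => fun_of_matrix v _ _ * fun_of_matrix v _ _
                          * fun_of_matrix v _ _) => exact: is_cubic_coord3
  | |- is_cubic (fun v => fun_of_matrix v _ _ * fun_of_matrix v _ _) =>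
      exact: is_cubic_coord2
  | |- is_cubic (fun v => fun_of_matrix v _ _) => exact: is_cubic_coord1
  | |- _ => first [exact: is_cubic0 | apply: is_cubic_sum => ?]
  end.

(* ** The forms alpha_{p,q} *)

Definition alpha_fun p q (v : 'cV['F_2]_(p + q)) : 'F_2 :=
  let n := (p + q)%N in
  \sum_(i < n) \sum_(j < n | (i < j)%N) \sum_(k < n | (j < k)%N)
    v i 0 * v j 0 * v k 0
  + \sum_(i < n) \sum_(j < n | (i < j)%N) v i 0 * v j 0
  + \sum_(i < n) v i 0
  + \sum_(i < n | (i < p)%N) v i 0.

Lemma alpha_cubic p q : is_cubic (@alpha_fun p q).
Proof. by rewrite /alpha_fun /=; solve_cubic. Qed.

Definition alpha p q : cubic_form (p + q) := CubicForm (alpha_cubic p q).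

(* ** The forms alpha~_{p,q}

   [atpq] is the explicitly given form of signature (p, q). *)

Definition at03 (x1 x2 x3 : 'F_2) : 'F_2 :=
  x1 * x2 * x3 + x1 * x2 + x1 * x3 + x2 * x3 + x1 + x2 + x3.
Definition at04 (x1 x2 x3 x4 : 'F_2) : 'F_2 :=
  x1 * x3 * x4 + x1 * x3 + x1 * x4 + x3 * x4 + x1 + x3 + x4.
Definition at05 (x1 x2 x3 x4 x5 : 'F_2) : 'F_2 :=
  x1 * x2 * x3 + x1 * x4 * x5 + x2 * x3 + x1 * x4 + x1 * x5 + x4 * x5
  + x1 + x4 + x5.
Definition at06 (x1 x2 x3 x4 x5 x6 : 'F_2) : 'F_2 :=
  x1 * x3 * x4 + x1 * x5 * x6 + x1 * x2 + x3 * x4 + x1 * x5 + x1 * x6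
  + x5 * x6 + x1 + x2 + x5 + x6.

Definition at12 (x1 x2 x3 : 'F_2) : 'F_2 :=
  x1 * x2 * x3 + x1 * x2 + x1 * x3 + x2 * x3 + x1.
Definition at22 (x1 x2 x3 x4 : 'F_2) : 'F_2 :=
  x1 * x3 * x4 + x1 * x3 + x1 * x4 + x3 * x4 + x1.
Definition at13 (x1 x2 x3 x4 : 'F_2) : 'F_2 :=
  x1 * x3 * x4 + x1 * x3 + x1 * x4 + x3 * x4 + x1 + x2 + x4.
Definition at23 (x1 x2 x3 x4 x5 : 'F_2) : 'F_2 :=
  x1 * x2 * x3 + x1 * x4 * x5 + x2 * x3 + x1 * x4 + x1 * x5 + x4 * x5 + x1.
Definition at14 (x1 x2 x3 x4 x5 : 'F_2) : 'F_2 :=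
  x1 * x2 * x3 + x1 * x4 * x5 + x2 * x3 + x1 * x4 + x1 * x5 + x4 * x5
  + x1 + x2 + x3.
Definition at33 (x1 x2 x3 x4 x5 x6 : 'F_2) : 'F_2 :=
  x1 * x3 * x4 + x1 * x5 * x6 + x1 * x2 + x3 * x4 + x1 * x5 + x1 * x6
  + x5 * x6 + x1.
Definition at24 (x1 x2 x3 x4 x5 x6 : 'F_2) : 'F_2 :=
  x1 * x3 * x4 + x1 * x5 * x6 + x1 * x2 + x3 * x4 + x1 * x5 + x1 * x6
  + x5 * x6 + x1 + x2 + x3 + x4.
Definition at15 (x1 x2 x3 x4 x5 x6 : 'F_2) : 'F_2 :=
  x1 * x3 * x4 + x1 * x5 * x6 + x1 * x2 + x3 * x4 + x1 * x5 + x1 * x6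
  + x5 * x6 + x1 + x5 + x6.
Definition at25 (x1 x2 x3 x4 x5 x6 x7 : 'F_2) : 'F_2 :=
  x1 * x2 * x3 + x1 * x4 * x5 + x1 * x6 * x7 + x1 * x2 + x1 * x3 + x2 * x3
  + x4 * x5 + x1 * x6 + x1 * x7 + x6 * x7 + x1 + x6 + x7.
Definition at26 (x1 x2 x3 x4 x5 x6 x7 x8 : 'F_2) : 'F_2 :=
  x1 * x3 * x4 + x1 * x5 * x6 + x1 * x7 * x8 + x1 * x3 + x1 * x4 + x3 * x4
  + x5 * x6 + x1 * x7 + x1 * x8 + x7 * x8 + x1 + x7 + x8.
Definition at36 (x1 x2 x3 x4 x5 x6 x7 x8 x9 : 'F_2) : 'F_2 :=
  x1 * x2 * x3 + x1 * x4 * x5 + x1 * x6 * x7 + x1 * x8 * x9 + x2 * x3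
  + x4 * x5 + x1 * x6 + x1 * x7 + x6 * x7 + x1 * x8 + x1 * x9 + x8 * x9
  + x1 + x8 + x9.

(* From here on a point is given by its sequence x : nat -> 'F_2 of
   coordinates, of which x 1, ..., x n are used in dimension n. *)

(* Signature (0, n); meaningful for n >= 3 only. *)
Definition atilde_0n (n : nat) (x : nat -> 'F_2) : 'F_2 :=
  let k := (n %/ 4)%N in
  match (n %% 4)%N with
  | 3%N => at03 (x 1%N) (x 2%N) (x 3%N)
         + \sum_(1 <= i < k.+1)
             (x 1%N + at05 (x 1%N) (x (4 * i)%N) (x (4 * i + 1)%N)
                                   (x (4 * i + 2)%N) (x (4 * i + 3)%N))
  | 0%N => at04 (x 1%N) (x 2%N) (x 3%N) (x 4%N)
         + \sum_(1 <= i < k)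
             (x 1%N + at05 (x 1%N) (x (4 * i + 1)%N) (x (4 * i + 2)%N)
                                   (x (4 * i + 3)%N) (x (4 * i + 4)%N))
  | 1%N => at05 (x 1%N) (x 2%N) (x 3%N) (x 4%N) (x 5%N)
         + \sum_(1 <= i < k)
             (x 1%N + at05 (x 1%N) (x (4 * i + 2)%N) (x (4 * i + 3)%N)
                                   (x (4 * i + 4)%N) (x (4 * i + 5)%N))
  | _ => at06 (x 1%N) (x 2%N) (x 3%N) (x 4%N) (x 5%N) (x 6%N)
         + \sum_(1 <= i < k)
             (x 1%N + at05 (x 1%N) (x (4 * i + 3)%N) (x (4 * i + 4)%N)
                                   (x (4 * i + 5)%N) (x (4 * i + 6)%N))
  end.

(* The defining rules for signatures (p, q) with p, q > 0. The signature
   (p, q) on the right of [mixed_step] is also required to satisfy p, q > 0: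
   for (p, q) = (0, 3) the rule would contradict the value at (2, 5). *)
Record mixed_rules (T : nat -> nat -> (nat -> 'F_2) -> 'F_2) : Prop := {
  mixed12 : forall x, T 1%N 2%N x = at12 (x 1%N) (x 2%N) (x 3%N);
  mixed22 : forall x, T 2%N 2%N x = at22 (x 1%N) (x 2%N) (x 3%N) (x 4%N);
  mixed13 : forall x, T 1%N 3%N x = at13 (x 1%N) (x 2%N) (x 3%N) (x 4%N);
  mixed23 : forall x,
    T 2%N 3%N x = at23 (x 1%N) (x 2%N) (x 3%N) (x 4%N) (x 5%N);
  mixed14 : forall x,
    T 1%N 4%N x = at14 (x 1%N) (x 2%N) (x 3%N) (x 4%N) (x 5%N);
  mixed33 : forall x,
    T 3%N 3%N x = at33 (x 1%N) (x 2%N) (x 3%N) (x 4%N) (x 5%N) (x 6%N);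
  mixed24 : forall x,
    T 2%N 4%N x = at24 (x 1%N) (x 2%N) (x 3%N) (x 4%N) (x 5%N) (x 6%N);
  mixed15 : forall x,
    T 1%N 5%N x = at15 (x 1%N) (x 2%N) (x 3%N) (x 4%N) (x 5%N) (x 6%N);
  mixed25 : forall x,
    T 2%N 5%N x = at25 (x 1%N) (x 2%N) (x 3%N) (x 4%N) (x 5%N) (x 6%N) (x 7%N);
  mixed26 : forall x,
    T 2%N 6%N x = at26 (x 1%N) (x 2%N) (x 3%N) (x 4%N) (x 5%N) (x 6%N)
      (x 7%N) (x 8%N);
  mixed36 : forall x,
    T 3%N 6%N x = at36 (x 1%N) (x 2%N) (x 3%N) (x 4%N) (x 5%N) (x 6%N)
      (x 7%N) (x 8%N) (x 9%N);
  mixed_sym : forall p q x, (0 < p)%N -> (0 < q)%N -> (3 <= p + q)%N ->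
    T q p x = T p q x;
  mixed_shift : forall p q x, (0 < p)%N -> (0 < q)%N ->
    T p (q + 4)%N x = T (p + 4)%N q x;
  mixed_step : forall p q x, (0 < p)%N -> (0 < q)%N -> (3 <= p + q)%N ->
    (p, q) <> (1, 4)%N -> (p, q) <> (4, 1)%N ->
    let n := (p + q)%N in
    T (p + 2)%N (q + 2)%N x =
      T p q x + at23 (x 1%N) (x (n + 1)%N) (x (n + 2)%N) (x (n + 3)%N)
                           (x (n + 4)%N)
      + x 1%N
}.

(* [balanced p q] covers the signatures with 0 < p <= q <= p + 4, to which
   [mixed_sym] and [mixed_shift] reduce all the others. *)
Fixpoint balanced (p q : nat) (x : nat -> 'F_2) {struct p} : 'F_2 :=
  match p, q with
  | 1%N, 2%N => at12 (x 1%N) (x 2%N) (x 3%N)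
  | 2%N, 2%N => at22 (x 1%N) (x 2%N) (x 3%N) (x 4%N)
  | 1%N, 3%N => at13 (x 1%N) (x 2%N) (x 3%N) (x 4%N)
  | 2%N, 3%N => at23 (x 1%N) (x 2%N) (x 3%N) (x 4%N) (x 5%N)
  | 1%N, 4%N => at14 (x 1%N) (x 2%N) (x 3%N) (x 4%N) (x 5%N)
  | 3%N, 3%N => at33 (x 1%N) (x 2%N) (x 3%N) (x 4%N) (x 5%N) (x 6%N)
  | 2%N, 4%N => at24 (x 1%N) (x 2%N) (x 3%N) (x 4%N) (x 5%N) (x 6%N)
  | 1%N, 5%N => at15 (x 1%N) (x 2%N) (x 3%N) (x 4%N) (x 5%N) (x 6%N)
  | 2%N, 5%N => at25 (x 1%N) (x 2%N) (x 3%N) (x 4%N) (x 5%N) (x 6%N) (x 7%N)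
  | 2%N, 6%N =>
      at26 (x 1%N) (x 2%N) (x 3%N) (x 4%N) (x 5%N) (x 6%N) (x 7%N) (x 8%N)
  | 3%N, 6%N =>
      at36 (x 1%N) (x 2%N) (x 3%N) (x 4%N) (x 5%N) (x 6%N) (x 7%N) (x 8%N)
        (x 9%N)
  | p'.+2, q'.+2 =>
      let n := (p' + q')%N in
      balanced p' q' x
      + at23 (x 1%N) (x (n + 1)%N) (x (n + 2)%N) (x (n + 3)%N) (x (n + 4)%N)
      + x 1%N
  | _, _ => 0
  end.

(* Given p + q, the rules [mixed_sym] and [mixed_shift] preserve the distance
   from p - q to the nearest multiple of 8. *)
Definition gap (p q : nat) : nat :=
  let d := ((p - q + (q - p)) %% 8)%N in minn d (8 - d).

(* Junk unless p, q > 0 and p + q >= 3. *)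
Definition atilde_mixed (p q : nat) (x : nat -> 'F_2) : 'F_2 :=
  balanced ((p + q - gap p q)./2) ((p + q + gap p q)./2) x.

Lemma balanced_step p q x :
  (0 < p)%N -> (3 <= p + q)%N -> (p <= q)%N -> (p, q) <> (1, 4)%N ->
  let n := (p + q)%N in
  balanced p.+2 q.+2 x =
    balanced p q x
    + at23 (x 1%N) (x (n + 1)%N) (x (n + 2)%N) (x (n + 3)%N) (x (n + 4)%N)
    + x 1%N.
Proof.
case: p => [//|[|p]] _; last by case: q => [|[|q]].
by case: q => [|[|[|[|[|q]]]]].
Qed.

Lemma atilde_mixed_rules : mixed_rules atilde_mixed.
Proof.
split; do ?by [].
- move=> p q x _ _ _; rewrite /atilde_mixed (addnC q p).
  by rewrite (_ : gap q p = gap p q) // /gap addnC.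
- move=> p q x p0 q0; rewrite /atilde_mixed.
  rewrite (_ : (p + (q + 4) = p + 4 + q)%N); last by lia.
  by rewrite (_ : gap p (q + 4) = gap (p + 4) q) //; rewrite /gap; lia.
- move=> p q x p0 q0 pq3 npq nqp; rewrite /atilde_mixed.
  have -> : gap (p + 2) (q + 2) = gap p q by rewrite /gap; lia.
  set g := gap p q.
  have gle : (g <= 4)%N /\ (g <= p + q - 2)%N /\ odd (p + q + g) = false.
    by rewrite /g /gap; lia.
  have g3 : (p + q = 5 -> g = 3 -> (p = 1 /\ q = 4) \/ (p = 4 /\ q = 1))%N.
    by rewrite /g /gap; lia.
  have sE : ((p + q - g)./2 + (p + q + g)./2 = p + q)%N by lia.
  have -> : (p + 2 + (q + 2) - g)./2 = ((p + q - g)./2).+2 by lia.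
  have -> : (p + 2 + (q + 2) + g)./2 = ((p + q + g)./2).+2 by lia.
  rewrite balanced_step ?sE //; [lia|lia|].
  case=> e1 e4; case: g3 => [||[pE qE]|[pE qE]]; [lia|lia| |].
    by rewrite pE qE in npq.
  by rewrite pE qE in nqp.
Qed.

(* The rules determine the forms. *)
Lemma mixed_rules_unique S T : mixed_rules S -> mixed_rules T ->
  forall p q x, (0 < p)%N -> (0 < q)%N -> (3 <= p + q)%N -> S p q x = T p q x.
Proof.
move=> HS HT p q x p0 q0 pq3.
have [m] := ubnP ((p + q) * 2 + (p - q + (q - p)) * 2 + (q < p))%N.
elim: m p q p0 q0 pq3 => // m IH p q p0 q0 pq3 lem.
have [qp|pq] := ltnP q p.
  have qp3 : (3 <= q + p)%N by rewrite addnC.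
  by rewrite (mixed_sym HS x q0 p0 qp3) (mixed_sym HT x q0 p0 qp3) IH //; lia.
have [q4|q4] := ltnP (p + 4) q.
  have -> : q = (q - 4 + 4)%N by lia.
  have q40 : (0 < q - 4)%N by lia.
  by rewrite (mixed_shift HS x p0 q40) (mixed_shift HT x p0 q40) IH //; lia.
have step : (3 <= p)%N -> (3 <= p - 2 + (q - 2))%N ->
    (p - 2, q - 2)%N <> (1, 4)%N -> S p q x = T p q x.
  move=> p3 n3 n14.
  have [p20 q20] : (0 < p - 2)%N /\ (0 < q - 2)%N by lia.
  have n41 : (p - 2, q - 2)%N <> (4, 1)%N by case; lia.
  have := mixed_step HS x p20 q20 n3 n14 n41.
  have := mixed_step HT x p20 q20 n3 n14 n41.
  rewrite !subnK; [|lia..].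
  by move=> -> ->; rewrite IH //; lia.
case: p p0 q0 pq3 pq q4 {IH lem} step => [//|[|[|[|p]]]] _.
- case: q => [|[|[|[|[|[|q]]]]]]; try by []; move=> _ _ _ _ _.
  + by rewrite (mixed12 HS) (mixed12 HT).
  + by rewrite (mixed13 HS) (mixed13 HT).
  + by rewrite (mixed14 HS) (mixed14 HT).
  + by rewrite (mixed15 HS) (mixed15 HT).
- case: q => [|[|[|[|[|[|[|q]]]]]]]; try by []; move=> _ _ _ _ _.
  + by rewrite (mixed22 HS) (mixed22 HT).
  + by rewrite (mixed23 HS) (mixed23 HT).
  + by rewrite (mixed24 HS) (mixed24 HT).
  + by rewrite (mixed25 HS) (mixed25 HT).
  + by rewrite (mixed26 HS) (mixed26 HT).
- case: q => [|[|[|[|[|[|[|[|q]]]]]]]]; try by []; move=> _ _ _ _ step;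
    try by apply: step.
  + by rewrite (mixed33 HS) (mixed33 HT).
  + by rewrite (mixed36 HS) (mixed36 HT).
- by move=> q0 pq3 pq q4 step; apply: step; [|lia|case; lia].
Qed.

Definition atilde_val (p q : nat) (x : nat -> 'F_2) : 'F_2 :=
  if p == 0%N then atilde_0n q x
  else if q == 0%N then atilde_0n p x + x 1%N
  else atilde_mixed p q x.

Definition atilde_fun p q (v : 'cV['F_2]_(p + q)) : 'F_2 :=
  atilde_val p q (var v).

Lemma atilde_0n_cubic n m :
  is_cubic (fun v : 'cV['F_2]_m => atilde_0n n (var v)).
Proof.
rewrite /atilde_0n; case: (n %% 4)%N => [|[|[|[|r]]]];
  rewrite /at03 /at04 /at05 /at06; by solve_cubic.
Qed.

Lemma balanced_cubic p q m :
  is_cubic (fun v : 'cV['F_2]_m => balanced p q (var v)).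
Proof.
elim/ltn_ind: p q => p IH q; case: p IH => [|[|p]] IH.
- exact: is_cubic0.
- case: q => [|[|[|[|[|[|q]]]]]]; rewrite /= /at12 /at13 /at14 /at15;
    by solve_cubic.
have step r : is_cubic (fun v : 'cV['F_2]_m => let n := (p + r)%N in
    balanced p r (var v)
    + at23 (var v 1%N) (var v (n + 1)%N) (var v (n + 2)%N)
           (var v (n + 3)%N) (var v (n + 4)%N) + var v 1%N).
  apply: is_cubicD; last by solve_cubic.
  apply: is_cubicD; first by apply: IH; lia.
  by rewrite /at23; solve_cubic.
case: p IH step => [|[|p]] IH step; last first.
- by case: q => [|[|q]]; try exact: (step q); exact: is_cubic0.
- case: q => [|[|[|[|[|[|[|q]]]]]]];
    try exact: (step _); rewrite /= /at33 /at36; by solve_cubic.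
- case: q => [|[|[|[|[|[|[|q]]]]]]];
    try exact: (step _); rewrite /= /at22 /at23 /at24 /at25 /at26;
    by solve_cubic.
Qed.

Lemma atilde_cubic p q : is_cubic (@atilde_fun p q).
Proof.
rewrite /atilde_fun /atilde_val /atilde_mixed; case: (p == 0%N).
  exact: atilde_0n_cubic.
case: (q == 0%N); last exact: balanced_cubic.
by apply: is_cubicD; [exact: atilde_0n_cubic | exact: is_cubic_var1].
Qed.

Definition atilde p q : cubic_form (p + q) := CubicForm (atilde_cubic p q).

(* Main.v *)
From HB Require Import structures.
Require Import Defs.
From mathcomp Require Import all_boot all_order all_algebra.
From mathcomp Require Import zify ring.

(* By Lucas' theorem, alpha_{p,q}(x) is [4 does not divide |x|] plus the parity
   of the weight of x on the first p coordinates. The linear form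
   l = x_1 + ... + x_n becomes the variable x_1 of the normal form. If a is an
   old coordinate and y_1, ..., y_4 are new ones, the substitution
   a' = a + y_1 + ... + y_4, y_i' = y_i + a' preserves l and splits alpha into
   the form of the old coordinates (with a' in place of a) plus a form in l and
   the y_i'. This block is at23 + l when two of the y_i count for p and two for
   q, and at05 + l when the y_i are all of the same kind as a. Splitting off the
   latter block and glueing it back with the other kind turns (p, q + 4) into
   (p + 4, q), and everything reduces to the initial forms, for which an
   explicit substitution is checked on all points. *)

Set Implicit Arguments.
Unset Strict Implicit.
Unset Printing Implicit Defensive.

Import GRing.Theory.
Local Open Scope ring_scope.

(** * Arithmetic in F_2 and weights of points *)

Lemma F2_ind (P : 'F_2 -> Prop) : P 0 -> P 1 -> forall x, P x.
Proof.
move=> P0 P1 x; have [->//|x0] := eqVneq x 0.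
suff -> : x = 1 by [].
by apply/val_inj; case: x x0 => [[|[|m]]].
Qed.

Lemma natF2K (x : 'F_2) : (x : nat)%:R = x.
Proof. by apply/val_inj; move: x; apply: F2_ind. Qed.

Ltac case_mod4 u :=
  have := ltn_mod u 4; case: (u %% 4)%N => [|[|[|[|//]]]] _.

Lemma natF2_mod4 u : u%:R = (u %% 4)%:R :> 'F_2.
Proof.
rewrite {1}(divn_eq u 4) natrD natrM (_ : 4%:R = 0 :> 'F_2) ?mulr0 ?add0r //.
exact/val_inj.
Qed.

(* [alpha p q] at a point with [u] ones among its first [p] coordinates and [v]
   ones among the others; see [alpha_funE]. *)
Definition weight_form (u v : nat) : 'F_2 := (~~ (4 %| u + v)%N)%:R + u%:R.

(** Both 4-divisibility and parity depend only on residues mod 4. The summands [k] and [l] stay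
    explicit, so that an unknown weight becomes one of four values and the identities below become
    finite checks. *)
Lemma weight_form_mod4 k l u v :
  weight_form (k + u) (l + v) = weight_form (k + u %% 4) (l + v %% 4).
Proof.
rewrite /weight_form !natrD [u%:R]natF2_mod4.
by congr (_%:R + _); congr (nat_of_bool (~~ _)); lia.
Qed.

Definition weight (y : seq 'F_2) : nat := sumn (map (@nat_of_ord _) y).

Definition wt (D : zmodType) (e : {additive D -> 'F_2}) (r : seq D) : nat :=
  weight (map e r).

Section Wt.
Variables (D : zmodType) (e : {additive D -> 'F_2}).

Lemma wt_cons a r : wt e (a :: r) = (e a + wt e r)%N.
Proof. by []. Qed.

Lemma wt_cons0 a r : wt e (a :: r) = 0%N -> e a = 0 /\ wt e r = 0%N.
Proof.
rewrite wt_cons => /eqP; rewrite addn_eq0 => /andP[/eqP ea /eqP ->].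
by split=> //; apply/val_inj.
Qed.

Lemma wt_cat r s : wt e (r ++ s) = (wt e r + wt e s)%N.
Proof. by rewrite /wt /weight !map_cat sumn_cat. Qed.

Lemma additive_sum_wt r : e (\sum_(a <- r) a) = (wt e r)%:R.
Proof.
elim: r => [|a r IHr]; first by rewrite big_nil raddf0.
by rewrite big_cons wt_cons raddfD natrD IHr natF2K.
Qed.

End Wt.

(** * Realizability by a linear substitution *)

(* [D] plays the role of the dual of F_2^n, and an additive [e] that of
   evaluation at a point: the coordinates [P ++ N] are replaced by new linear
   coordinates [d], the first of which is the sum of [P ++ N], so that
   [weight_form] turns into [T] at [d]. The condition on [wt e d] says that the
   substitution is injective. *)
Definition realizable p q (T : (nat -> 'F_2) -> 'F_2) :=
  forall (D : zmodType) (P N : seq D), size P = p -> size N = q ->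
  exists2 d : seq D, size d = (p + q)%N & forall e : {additive D -> 'F_2},
    (wt e d = 0 -> wt e P = 0 /\ wt e N = 0)%N /\
    forall x, (forall i, (i < p + q)%N -> x i.+1 = e d`_i) ->
      x 1%N = (wt e P + wt e N)%:R /\ weight_form (wt e P) (wt e N) = T x.

Lemma realizable_ext p q T T' :
  T =1 T' -> realizable p q T -> realizable p q T'.
Proof.
move=> TT' rT D P N sP sN; have [d sd dP] := rT D P N sP sN.
exists d => // e; have [inj_d dE] := dP e; split=> // x xE.
by rewrite -TT'; apply: dE.
Qed.

(** Since the sum of all coordinates is the same for [P], [N] and for [P'], [N'], the block [B] and
    the form [T] share the variable x_1. Appending [y] to the coordinates that realize [T] then
    realizes the sum of the two. *)
Lemma realizable_glue p q p' q' T m (B : 'F_2 -> seq 'F_2 -> 'F_2) :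
  (0 < p' + q')%N -> (p + q = p' + q' + m)%N ->
  (forall (D : zmodType) (P N : seq D), size P = p -> size N = q ->
    exists P' N' y : seq D, [/\ size P' = p', size N' = q', size y = m &
    forall e : {additive D -> 'F_2},
      [/\ (wt e P' = 0 -> wt e N' = 0 -> wt e y = 0 ->
             wt e P = 0 /\ wt e N = 0)%N,
         (wt e P + wt e N)%:R = (wt e P' + wt e N')%:R :> 'F_2
       & weight_form (wt e P) (wt e N)
         = weight_form (wt e P') (wt e N')
           + B (wt e P + wt e N)%:R (map e y)]]) ->
  realizable p' q' T ->
  realizable p q (fun x =>
    T x + B (x 1%N) [seq x (p' + q' + i).+1 | i <- iota 0 m]).
Proof.
move=> n0 nE split_PN rT D P N sP sN.
have [P' [N' [y [sP' sN' sy eE]]]] := split_PN D P N sP sN.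
have [d sd dP] := rT D P' N' sP' sN'.
exists (d ++ y); first by rewrite size_cat sd sy nE.
move=> e; have [inj_e sum_e form_e] := eE e; have [inj_d dE] := dP e.
split=> [|x xE].
  rewrite wt_cat => /eqP; rewrite addn_eq0 => /andP[/eqP/inj_d[? ?] /eqP].
  exact: inj_e.
have [i lti|x1 Tx] := dE x.
  by rewrite xE; [rewrite nth_cat sd lti | rewrite nE ltn_addr].
rewrite x1 sum_e; split=> //; rewrite form_e Tx sum_e; congr (_ + B _ _).
apply: (@eq_from_nth _ 0) => [|i]; rewrite !size_map ?size_iota sy // => lti.
rewrite (nth_map 0) ?sy // (nth_map 0%N) ?size_iota // nth_iota //.
rewrite xE; last by rewrite nE ltn_add2l.
by rewrite nth_cat sd ltnNge leq_addr /= addKn.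
Qed.

(** This is gluing with an empty block. *)
Lemma realizable_move p q p' q' T :
  (0 < p' + q')%N -> (p + q = p' + q')%N ->
  (forall (D : zmodType) (P N : seq D), size P = p -> size N = q ->
    exists P' N' : seq D, [/\ size P' = p', size N' = q' &
    forall e : {additive D -> 'F_2},
      [/\ (wt e P' = 0 -> wt e N' = 0 -> wt e P = 0 /\ wt e N = 0)%N,
         (wt e P + wt e N)%:R = (wt e P' + wt e N')%:R :> 'F_2
       & weight_form (wt e P) (wt e N) = weight_form (wt e P') (wt e N')]]) ->
  realizable p' q' T -> realizable p q T.
Proof.
move=> n0 nE move_PN rT.
apply: (@realizable_ext p q (fun x => T x + 0)) => [x|]; first by rewrite addr0.
apply: (@realizable_glue p q p' q' T 0%N (fun _ _ => 0)) => //.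
  by rewrite addn0.
move=> D P N sP sN; have [P' [N' [sP' sN' eE]]] := move_PN D P N sP sN.
exists P', N', [::]; split=> // e; have [inj_e sum_e form_e] := eE e.
by split=> [P0 N0 _||]; [exact: inj_e | | rewrite addr0].
Qed.

(** * Realizability by a finite check *)

Fixpoint cube n : seq (seq 'F_2) :=
  if n is n'.+1 then map (cons 0) (cube n') ++ map (cons 1) (cube n')
  else [:: [::]].

Lemma mem_cube (y : seq 'F_2) : y \in cube (size y).
Proof.
elim: y => [//|a y IHy] /=; rewrite mem_cat; move: a.
by apply: F2_ind; rewrite map_f ?orbT.
Qed.

Definition subsum (V : zmodType) (c : seq V) (r : seq nat) : V :=
  foldr (fun j s => c`_j + s) 0 r.

Lemma raddf_subsum (D : zmodType) (e : {additive D -> 'F_2}) c r :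
  e (subsum c r) = subsum (map e c) r.
Proof.
elim: r => [|j r IHr] /=; rewrite ?raddf0 // raddfD IHr; congr (_ + _).
have [ltj|lej] := ltnP j (size c); first by rewrite (nth_map 0).
by rewrite !nth_default ?size_map // raddf0.
Qed.

(** Each entry of [M] lists the old coordinates, numbered from 0 with those of [P] first, whose sum
    is one new coordinate. *)
Definition base_check p q (t : seq 'F_2 -> 'F_2) (M : seq (seq nat)) :=
  (size M == p + q)%N &&
  all (fun y => let d := map (subsum y) M in
         [&& (weight d == 0%N) ==> (weight y == 0%N),
             d`_0 == (weight y)%:R
           & weight_form (weight (take p y)) (weight (drop p y)) == t d])
      (cube (p + q)).

(** A functional [e] enters only through its values on [P ++ N], which form one of the tested
    points. *)
Lemma realizable_base p q t M : (0 < p + q)%N -> base_check p q t M ->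
  realizable p q (fun x => t (mkseq (fun i => x i.+1) (p + q))).
Proof.
move=> n0 /andP[/eqP sM /allP checkM] D P N sP sN.
exists (map (subsum (P ++ N)) M); first by rewrite size_map.
move=> e; pose y := map e (P ++ N).
have sy : size y = (p + q)%N by rewrite size_map size_cat sP sN.
have /checkM : y \in cube (p + q) by rewrite -sy mem_cube.
have -> : take p y = map e P by rewrite /y map_cat take_size_cat ?size_map.
have -> : drop p y = map e N by rewrite /y map_cat drop_size_cat ?size_map.
have -> : map (subsum y) M = map e (map (subsum (P ++ N)) M).
  by rewrite -map_comp; apply: eq_map => r /=; rewrite raddf_subsum.
set d := map (subsum _) M => /and3P[inj_d /eqP d0 /eqP formE].
have sd : size d = (p + q)%N by rewrite size_map.
have wtE : weight y = (wt e P + wt e N)%N by rewrite -wt_cat.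
rewrite wtE in inj_d d0; split=> [wd|x xE].
  by move: inj_d; rewrite [weight _]wd addn_eq0 => /andP[/eqP ? /eqP ?].
have dE : mkseq (fun i => x i.+1) (p + q) = map e d.
  apply: (@eq_from_nth _ 0) => [|i]; rewrite size_mkseq ?size_map ?sd // => lti.
  by rewrite nth_mkseq // xE // (nth_map 0) ?sd.
by rewrite dE -formE -d0 (nth_map 0) ?sd // -xE.
Qed.

(** * Moves between signatures *)

(* With [l] the sum of all coordinates, replacing [a] by [a + l] and [b] by
   [b + l] only affects the points with [l = 1], where it changes the parity of
   the weight on [P]; on [l = 0] this parity agrees with that on [N]. *)
Lemma realizable_swap p q T : (0 < p)%N -> (0 < q)%N ->
  realizable p q T -> realizable q p T.
Proof.
move=> p0 q0; apply: (@realizable_move q p p q) => [||D].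
- by rewrite addn_gt0 p0.
- exact: addnC.
move=> [|a P] [|b N] sP sN; try by move: p0 q0; rewrite -sP -sN.
pose l := \sum_(r <- (a :: P) ++ b :: N) r.
exists (b + l :: N), (a + l :: P); split=> // e.
have el : e l = e a + e b + (wt e P)%:R + (wt e N)%:R.
  rewrite additive_sum_wt wt_cat !wt_cons !natrD !natF2K addrACA.
  by rewrite !addrA.
split.
- move=> /wt_cons0[eb eN] /wt_cons0[ea eP]; move: ea eb.
  rewrite !wt_cons !(raddfD e) el eN eP; move: (e a) (e b).
  by do 2!apply: F2_ind.
- rewrite !wt_cons !(raddfD e) el !natrD !natF2K !(natF2_mod4 (wt e _)).
  move: (e a) (e b); do 2!apply: F2_ind;
    by case_mod4 (wt e P); case_mod4 (wt e N);
      apply/val_inj; vm_compute; reflexivity.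
- rewrite !wt_cons !(raddfD e) el !(natF2_mod4 (wt e _)).
  rewrite weight_form_mod4 [RHS]weight_form_mod4.
  move: (e a) (e b); do 2!apply: F2_ind;
    by case_mod4 (wt e P); case_mod4 (wt e N);
      apply/val_inj; vm_compute; reflexivity.
Qed.

Lemma realizable_hyperbolic p q T : (0 < q)%N ->
  realizable p q T -> realizable p.+2 q.+2 (fun x => T x +
    (at23 (x 1%N) (x (p + q + 1)%N) (x (p + q + 2)%N) (x (p + q + 3)%N)
          (x (p + q + 4)%N) + x 1%N)).
Proof.
move=> q0 rT; pose B l (s : seq 'F_2) := at23 l s`_0 s`_1 s`_2 s`_3 + l.
apply: (@realizable_ext _ _ (fun x =>
    T x + B (x 1%N) [seq x (p + q + i).+1 | i <- iota 0 4])) => [x|].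
  by rewrite /B /= addn0 !addnS addn0.
apply: realizable_glue rT => [||D]; rewrite ?addn_gt0 ?q0 ?orbT //; first lia.
move=> [|y1 [|y2 P]] // [|y3 [|y4 [|a N]]] //= [sP] [sN]; first by lia.
pose a' := a + (y1 + y2 + y3 + y4).
(* With Y_i = y_i + a', the new coordinates are Y_4, Y_3, Y_2 + Y_3 + Y_4 and Y_1 + Y_3 + Y_4, a
   basis in which the block reads [at23] + l. *)
exists P, (a' :: N),
  [:: y4 + a'; y3 + a'; y2 + y3 + y4 + a'; y1 + y3 + y4 + a'].
split=> // e.
have ea' : e a' = e a + (e y1 + e y2 + e y3 + e y4) by rewrite !raddfD.
have sumE : (wt e [:: y1, y2 & P] + wt e [:: y3, y4, a & N])%:R
    = e y1 + e y2 + e y3 + e y4 + e a + (wt e P)%:R + (wt e N)%:R :> 'F_2.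
  by rewrite !wt_cons !natrD !natF2K; ring.
split.
- move=> eP /wt_cons0[ea0 eN].
  move=> /wt_cons0[e4 /wt_cons0[e3 /wt_cons0[e2 /wt_cons0[e1 _]]]].
  move: ea0 e1 e2 e3 e4; rewrite !wt_cons eP eN !raddfD ?ea'.
  by move: (e a) (e y1) (e y2) (e y3) (e y4); do 5!apply: F2_ind.
- rewrite sumE natrD wt_cons natrD natF2K ea'; ring.
- rewrite sumE !wt_cons !addnA /B /= !raddfD ?ea' !(natF2_mod4 (wt e _)).
  (* Only five bits and two residues mod 4 are left to enumerate. *)
  rewrite weight_form_mod4 (weight_form_mod4 0 _ (wt e P)) add0n.
  move: (e a) (e y1) (e y2) (e y3) (e y4); do 5!apply: F2_ind;
    by case_mod4 (wt e P); case_mod4 (wt e N);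
      apply/val_inj; vm_compute; reflexivity.
Qed.

Lemma realizable_elliptic p q T : (0 < q)%N ->
  realizable p q T -> realizable p (q + 4) (fun x => T x +
    (x 1%N + at05 (x 1%N) (x (p + q + 1)%N) (x (p + q + 2)%N)
                          (x (p + q + 3)%N) (x (p + q + 4)%N))).
Proof.
move=> q0 rT; pose B l (s : seq 'F_2) := l + at05 l s`_0 s`_1 s`_2 s`_3.
apply: (@realizable_ext _ _ (fun x =>
    T x + B (x 1%N) [seq x (p + q + i).+1 | i <- iota 0 4])) => [x|].
  by rewrite /B /= addn0 !addnS addn0.
apply: realizable_glue rT => [||D]; rewrite ?addn_gt0 ?q0 ?orbT //; first lia.
move=> P; rewrite addn4.
move=> [|y1 [|y2 [|y3 [|y4 [|a N]]]]] //= [sP] [sN]; first by lia.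
pose a' := a + (y1 + y2 + y3 + y4).
(* With Y_i = y_i + a', these are Y_4, Y_3, Y_1 + Y_2 and Y_2 + Y_3 + Y_4, a basis in which the
   block reads l + [at05]. *)
exists P, (a' :: N), [:: y4 + a'; y3 + a'; y1 + y2; y2 + y3 + y4 + a'].
split=> // e.
have ea' : e a' = e a + (e y1 + e y2 + e y3 + e y4) by rewrite !raddfD.
have sumE : (wt e P + wt e [:: y1, y2, y3, y4, a & N])%:R
    = e y1 + e y2 + e y3 + e y4 + e a + (wt e P)%:R + (wt e N)%:R :> 'F_2.
  by rewrite !wt_cons !natrD !natF2K; ring.
split.
- move=> eP /wt_cons0[ea0 eN].
  move=> /wt_cons0[e4 /wt_cons0[e3 /wt_cons0[e2 /wt_cons0[e1 _]]]].
  move: ea0 e1 e2 e3 e4; rewrite !wt_cons eP eN !raddfD ?ea'.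
  by move: (e a) (e y1) (e y2) (e y3) (e y4); do 5!apply: F2_ind.
- rewrite sumE natrD wt_cons natrD natF2K ea'; ring.
- rewrite sumE !wt_cons !addnA /B /= !raddfD ?ea' !(natF2_mod4 (wt e _)).
  rewrite (weight_form_mod4 0 _ (wt e P)).
  rewrite [X in _ = X + _](weight_form_mod4 0 _ (wt e P)) !add0n.
  move: (e a) (e y1) (e y2) (e y3) (e y4); do 5!apply: F2_ind;
    by case_mod4 (wt e P); case_mod4 (wt e N);
      apply/val_inj; vm_compute; reflexivity.
Qed.

Lemma realizable_shift p q T : (0 < p)%N -> (0 < q)%N ->
  realizable (p + 4) q T -> realizable p (q + 4) T.
Proof.
move=> p0 q0; apply: (@realizable_move _ _ (p + 4) q); [lia|lia|move=> D].
rewrite !addn4 => - [|b P] [|y1 [|y2 [|y3 [|y4 [|a N]]]]] //= sP [sN].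
- by rewrite -sP in p0.
- by rewrite -sP in p0.
- by rewrite -sN in q0.
pose t := y1 + y2 + y3 + y4; pose c := a + t + b.
(* Splitting off the y_i leaves a' = a + t and Y_i = y_i + a'. The inverse substitution, with b in
   the place of a', glues the Y_i to [P]: it gives Y_i + b = y_i + c and b + t, as the four copies
   of c cancel. *)
exists [:: y1 + c, y2 + c, y3 + c, y4 + c, b + t & P], (a + t :: N).
split=> /= [||e]; [by rewrite -sP|by rewrite -sN|].
have et : e t = e y1 + e y2 + e y3 + e y4 by rewrite !raddfD.
have ec : e c = e a + e t + e b by rewrite !raddfD.
rewrite et in ec.
split.
- move=> /wt_cons0[e1 /wt_cons0[e2 /wt_cons0[e3 /wt_cons0[e4 +]]]].
  move=> /wt_cons0[eb eP] /wt_cons0[ea eN]; move: e1 e2 e3 e4 eb ea.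
  rewrite !wt_cons eP eN !(raddfD e) ?ec ?et.
  by move: (e a) (e b) (e y1) (e y2) (e y3) (e y4); do 6!apply: F2_ind.
- rewrite !wt_cons !natrD !natF2K !(raddfD e) ?ec ?et.
  move: ((wt e P)%:R : 'F_2) ((wt e N)%:R : 'F_2) => u v.
  move: u v (e a) (e b) (e y1) (e y2) (e y3) (e y4).
  by do 8!apply: F2_ind; apply/val_inj.
- rewrite !wt_cons !addnA !(raddfD e) ?ec ?et.
  rewrite weight_form_mod4 [RHS]weight_form_mod4.
  move: (e a) (e b) (e y1) (e y2) (e y3) (e y4); do 6!apply: F2_ind;
    by case_mod4 (wt e P); case_mod4 (wt e N);
      apply/val_inj; vm_compute; reflexivity.
Qed.

(** * Explicit substitutions for the initial forms *)

Lemma realizable_at03 : realizable 0 3 (fun x => at03 (x 1%N) (x 2%N) (x 3%N)).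
Proof.
apply: (@realizable_base 0 3 (fun d => at03 d`_0 d`_1 d`_2) [::
    [:: 0; 1; 2];
    [:: 1];
    [:: 2]]%N); by vm_compute.
Qed.

Lemma realizable_at04 :
  realizable 0 4 (fun x => at04 (x 1%N) (x 2%N) (x 3%N) (x 4%N)).
Proof.
apply: (@realizable_base 0 4 (fun d => at04 d`_0 d`_1 d`_2 d`_3) [::
    [:: 0; 1; 2; 3];
    [:: 3];
    [:: 1; 3];
    [:: 2; 3]]%N); by vm_compute.
Qed.

Lemma realizable_at05 :
  realizable 0 5 (fun x => at05 (x 1%N) (x 2%N) (x 3%N) (x 4%N) (x 5%N)).
Proof.
apply: (@realizable_base 0 5 (fun d => at05 d`_0 d`_1 d`_2 d`_3 d`_4) [::
    [:: 0; 1; 2; 3; 4];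
    [:: 3];
    [:: 4];
    [:: 1; 3; 4];
    [:: 2; 3; 4]]%N); by vm_compute.
Qed.

Lemma realizable_at06 : realizable 0 6 (fun x => at06
  (x 1%N) (x 2%N) (x 3%N) (x 4%N) (x 5%N) (x 6%N)).
Proof.
apply: (@realizable_base 0 6 (fun d => at06 d`_0 d`_1 d`_2 d`_3 d`_4 d`_5) [::
    [:: 0; 1; 2; 3; 4; 5];
    [:: 5];
    [:: 3; 5];
    [:: 4; 5];
    [:: 1; 3; 4; 5];
    [:: 2; 3; 4; 5]]%N); by vm_compute.
Qed.

Lemma realizable_at12 : realizable 1 2 (fun x => at12 (x 1%N) (x 2%N) (x 3%N)).
Proof.
apply: (@realizable_base 1 2 (fun d => at12 d`_0 d`_1 d`_2) [::
    [:: 0; 1; 2];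
    [:: 0; 2];
    [:: 2]]%N); by vm_compute.
Qed.

Lemma realizable_at22 :
  realizable 2 2 (fun x => at22 (x 1%N) (x 2%N) (x 3%N) (x 4%N)).
Proof.
apply: (@realizable_base 2 2 (fun d => at22 d`_0 d`_1 d`_2 d`_3) [::
    [:: 0; 1; 2; 3];
    [:: 3];
    [:: 0; 3];
    [:: 1; 3]]%N); by vm_compute.
Qed.

Lemma realizable_at13 :
  realizable 1 3 (fun x => at13 (x 1%N) (x 2%N) (x 3%N) (x 4%N)).
Proof.
apply: (@realizable_base 1 3 (fun d => at13 d`_0 d`_1 d`_2 d`_3) [::
    [:: 0; 1; 2; 3];
    [:: 3];
    [:: 0; 3];
    [:: 2; 3]]%N); by vm_compute.
Qed.

Lemma realizable_at23 :
  realizable 2 3 (fun x => at23 (x 1%N) (x 2%N) (x 3%N) (x 4%N) (x 5%N)).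
Proof.
apply: (@realizable_base 2 3 (fun d => at23 d`_0 d`_1 d`_2 d`_3 d`_4) [::
    [:: 0; 1; 2; 3; 4];
    [:: 3];
    [:: 4];
    [:: 0; 3; 4];
    [:: 1; 3; 4]]%N); by vm_compute.
Qed.

Lemma realizable_at14 :
  realizable 1 4 (fun x => at14 (x 1%N) (x 2%N) (x 3%N) (x 4%N) (x 5%N)).
Proof.
apply: (@realizable_base 1 4 (fun d => at14 d`_0 d`_1 d`_2 d`_3 d`_4) [::
    [:: 0; 1; 2; 3; 4];
    [:: 3];
    [:: 4];
    [:: 0; 2];
    [:: 2; 3; 4]]%N); by vm_compute.
Qed.

Lemma realizable_at33 : realizable 3 3 (fun x => at33
  (x 1%N) (x 2%N) (x 3%N) (x 4%N) (x 5%N) (x 6%N)).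
Proof.
apply: (@realizable_base 3 3 (fun d => at33 d`_0 d`_1 d`_2 d`_3 d`_4 d`_5) [::
    [:: 0; 1; 2; 3; 4; 5];
    [:: 5];
    [:: 1; 5];
    [:: 2; 5];
    [:: 0; 4];
    [:: 1; 2; 4; 5]]%N); by vm_compute.
Qed.

Lemma realizable_at24 : realizable 2 4 (fun x => at24
  (x 1%N) (x 2%N) (x 3%N) (x 4%N) (x 5%N) (x 6%N)).
Proof.
apply: (@realizable_base 2 4 (fun d => at24 d`_0 d`_1 d`_2 d`_3 d`_4 d`_5) [::
    [:: 0; 1; 2; 3; 4; 5];
    [:: 1];
    [:: 1; 4];
    [:: 1; 5];
    [:: 0; 3];
    [:: 1; 3; 4; 5]]%N); by vm_compute.
Qed.

Lemma realizable_at15 : realizable 1 5 (fun x => at15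
  (x 1%N) (x 2%N) (x 3%N) (x 4%N) (x 5%N) (x 6%N)).
Proof.
apply: (@realizable_base 1 5 (fun d => at15 d`_0 d`_1 d`_2 d`_3 d`_4 d`_5) [::
    [:: 0; 1; 2; 3; 4; 5];
    [:: 0];
    [:: 0; 4];
    [:: 0; 5];
    [:: 0; 2; 4; 5];
    [:: 0; 3; 4; 5]]%N); by vm_compute.
Qed.

Lemma realizable_at25 : realizable 2 5 (fun x => at25
  (x 1%N) (x 2%N) (x 3%N) (x 4%N) (x 5%N) (x 6%N) (x 7%N)).
Proof.
apply: (@realizable_base 2 5
  (fun d => at25 d`_0 d`_1 d`_2 d`_3 d`_4 d`_5 d`_6) [::
    [:: 0; 1; 2; 3; 4; 5; 6];
    [:: 0; 3; 4; 5; 6];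
    [:: 1; 3; 4; 5; 6];
    [:: 3; 5; 6];
    [:: 4; 5; 6];
    [:: 6];
    [:: 5; 6]]%N); by vm_compute.
Qed.

Lemma realizable_at26 : realizable 2 6 (fun x => at26
  (x 1%N) (x 2%N) (x 3%N) (x 4%N) (x 5%N) (x 6%N) (x 7%N) (x 8%N)).
Proof.
apply: (@realizable_base 2 6
  (fun d => at26 d`_0 d`_1 d`_2 d`_3 d`_4 d`_5 d`_6 d`_7) [::
    [:: 0; 1; 2; 3; 4; 5; 6; 7];
    [:: 5; 6; 7];
    [:: 0; 3; 4; 5; 6; 7];
    [:: 1; 3; 4; 5; 6; 7];
    [:: 3; 5; 6; 7];
    [:: 4; 5; 6; 7];
    [:: 5; 7];
    [:: 5; 6]]%N); by vm_compute.
Qed.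

Lemma realizable_at36 : realizable 3 6 (fun x => at36
  (x 1%N) (x 2%N) (x 3%N) (x 4%N) (x 5%N) (x 6%N) (x 7%N) (x 8%N) (x 9%N)).
Proof.
apply: (@realizable_base 3 6
  (fun d => at36 d`_0 d`_1 d`_2 d`_3 d`_4 d`_5 d`_6 d`_7 d`_8) [::
    [:: 0; 1; 2; 3; 4; 5; 6; 7; 8];
    [:: 1; 5; 6; 7; 8];
    [:: 2; 5; 6; 7; 8];
    [:: 1; 2; 4; 5];
    [:: 0; 4; 6; 7; 8];
    [:: 0; 1; 2; 6; 7; 8];
    [:: 6; 7; 8];
    [:: 6; 8];
    [:: 6; 7]]%N); by vm_compute.
Qed.

(** * The form alpha in terms of weights *)

Lemma sum_gt_ord0 n (F : 'I_n.+1 -> 'F_2) :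
  \sum_(j < n.+1 | (@ord0 n < j)%N) F j = \sum_(j < n) F (lift ord0 j).
Proof. by rewrite big_mkcond big_ord_recl /= add0r. Qed.

Lemma sum_gt_lift n (i : 'I_n) (F : 'I_n.+1 -> 'F_2) :
  \sum_(j < n.+1 | (lift ord0 i < j)%N) F j
  = \sum_(j < n | (i < j)%N) F (lift ord0 j).
Proof. by rewrite big_mkcond big_ord_recl /= add0r -big_mkcond. Qed.

Lemma binF2_ord (a : 'F_2) w k :
  'C(a + w, k.+1)%:R = 'C(w, k.+1)%:R + a * 'C(w, k)%:R :> 'F_2.
Proof.
move: a; apply: F2_ind; first by rewrite mul0r addr0.
by rewrite mul1r binS natrD.
Qed.

(** A monomial is 1 exactly when its variables lie in the support of x, so the sum of degree k
    counts the k-subsets of the support. The induction splits off the first coordinate by Pascal's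
    rule. *)
Lemma elementary_sumsE n (x : 'I_n -> 'F_2) :
  let w := (\sum_(i < n) (x i : nat))%N in
  [/\ \sum_(i < n) x i = w%:R,
      \sum_(i < n) \sum_(j < n | (i < j)%N) x i * x j = 'C(w, 2)%:R
    & \sum_(i < n) \sum_(j < n | (i < j)%N) \sum_(k < n | (j < k)%N)
        x i * x j * x k = 'C(w, 3)%:R].
Proof.
elim: n x => [|n IHn] x; first by rewrite !big_ord0.
have /= [S1 S2 S3] := IHn (fun i => x (lift ord0 i)).
rewrite /= [in 'C(_, 2)]big_ord_recl [in 'C(_, 3)]big_ord_recl !binF2_ord bin1.
rewrite -S1 -S2 -S3; split.
- rewrite big_ord_recl [in RHS]big_ord_recl natrD natF2K; congr (_ + _).
  by rewrite natr_sum; apply: eq_bigr => i _; rewrite natF2K.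
- rewrite big_ord_recl sum_gt_ord0 -mulr_sumr addrC; congr (_ + _).
  by apply: eq_bigr => i _; rewrite sum_gt_lift.
- rewrite big_ord_recl sum_gt_ord0 addrC; congr (_ + _).
    by apply: eq_bigr => i _; rewrite sum_gt_lift; apply: eq_bigr => j _;
       rewrite sum_gt_lift.
  rewrite mulr_sumr; apply: eq_bigr => i _; rewrite sum_gt_lift mulr_sumr.
  by apply: eq_bigr => j _; rewrite mulrA.
Qed.

Lemma odd_bin23 w :
  odd 'C(w, 2) = (1 < w %% 4)%N /\ odd 'C(w, 3) = (w %% 4 == 3)%N.
Proof.
elim: w => [//|w [IH2 IH3]]; rewrite !binS !oddD IH2 IH3 bin1; split; lia.
Qed.

Lemma natF2_odd u : u%:R = (odd u)%:R :> 'F_2.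
Proof.
by rewrite -{1}(odd_double_half u) natrD -mul2n natrM (_ : 2%:R = 0 :> 'F_2)
  ?mul0r ?addr0 //; apply/val_inj.
Qed.

(** If r and s are the two lowest binary digits of w, the left side is rs + s + r, the disjunction
    of r and s. *)
Lemma bin123_mod4 w :
  'C(w, 3)%:R + 'C(w, 2)%:R + w%:R = (~~ (4 %| w)%N)%:R :> 'F_2.
Proof.
have [o2 o3] := odd_bin23 w.
rewrite (natF2_odd 'C(w, 3)) (natF2_odd 'C(w, 2)) (natF2_mod4 w) o2 o3 /dvdn.
by case_mod4 w; apply/val_inj.
Qed.

Lemma weight_enum n (f : 'I_n -> 'F_2) :
  weight [seq f i | i <- enum 'I_n] = (\sum_(i < n) (f i : nat))%N.
Proof. by rewrite /weight -map_comp sumnE big_map big_enum. Qed.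

Lemma alpha_funE p q (v : 'cV['F_2]_(p + q)) :
  alpha_fun v = weight_form (weight [seq v (lshift q i) 0 | i <- enum 'I_p])
                            (weight [seq v (rshift p i) 0 | i <- enum 'I_q]).
Proof.
have [S1 S2 S3] := elementary_sumsE (fun i => v i 0).
rewrite /alpha_fun S1 S2 S3 bin123_mod4 /weight_form big_split_ord /=.
rewrite !weight_enum; congr (_ + _).
rewrite big_mkcond big_split_ord /= [X in _ + X]big1 ?addr0 => [|i _].
  by rewrite natr_sum; apply: eq_bigr => i _; rewrite ltn_ord natF2K.
by rewrite ltnNge leq_addr.
Qed.

(** * Row vectors as linear forms, evaluated at a point *)

Lemma weight_eq0 y : (weight y == 0%N) = all (fun a => a == 0) y.
Proof. by elim: y => //= a y <-; rewrite addn_eq0 -val_eqE. Qed.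

Section Eval.
Variables (m : nat) (v : 'cV['F_2]_m).

Definition eval_row (r : 'rV['F_2]_m) : 'F_2 := (r *m v) 0 0.

Fact eval_row_is_zmod_morphism : zmod_morphism eval_row.
Proof. by move=> r s; rewrite /eval_row mulmxBl !mxE. Qed.

HB.instance Definition _ :=
  GRing.isZmodMorphism.Build _ _ eval_row eval_row_is_zmod_morphism.

Lemma eval_row_delta i : eval_row (delta_mx 0 i) = v i 0.
Proof. by rewrite /eval_row -rowE mxE. Qed.

End Eval.

Lemma varS n (v : 'cV['F_2]_n) (i : 'I_n) : var v i.+1 = v i 0.
Proof. by rewrite /var insubT //= => lti; congr (v _ 0); apply/val_inj. Qed.

(** * Induction on the signature *)

(** In all four residue classes of n mod 4 the last summand involves x_1 and the four newest
    variables, so a single recursion covers them. *)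
Lemma atilde_0n_step n x : (3 <= n)%N ->
  atilde_0n (n + 4) x = atilde_0n n x +
    (x 1%N + at05 (x 1%N) (x (n + 1)%N) (x (n + 2)%N) (x (n + 3)%N)
                          (x (n + 4)%N)).
Proof.
move=> n3; rewrite /atilde_0n modnDr divnDr // divnn /= addn1.
have := ltn_mod n 4; have := divn_eq n 4.
case: (n %% 4)%N => [|[|[|[|//]]]]; move: (n %/ 4)%N => k nE _;
  (rewrite big_nat_recr /=; last lia); rewrite -[RHS]addrA;
  do 3!congr (_ + _); move: at05 => f; congr (f _ _ _ _ _); congr (x _); lia.
Qed.

Lemma realizable_0n n : (3 <= n)%N -> realizable 0 n (atilde_0n n).
Proof.
elim/ltn_ind: n => n IHn n3; have [n7|] := ltnP 6 n.
  have nE : n = (n - 4 + 4)%N by lia.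
  have n43 : (3 <= n - 4)%N by lia.
  rewrite nE; apply: realizable_ext (fun x => esym (atilde_0n_step x n43)) _.
  by apply: realizable_elliptic; [lia | apply: IHn; lia].
move=> n6; have : n \in [:: 3; 4; 5; 6]%N by rewrite !inE; lia.
rewrite !inE => /or4P[] /eqP->;
  [ move: realizable_at03 | move: realizable_at04
  | move: realizable_at05 | move: realizable_at06 ];
  by apply: realizable_ext => x; rewrite /atilde_0n /= big_geq ?addr0.
Qed.

(** Moving all coordinates from [N] to [P] adds the parity of the total weight, which is x_1. *)
Lemma realizable_n0 n : (3 <= n)%N ->
  realizable n 0 (fun x => atilde_0n n x + x 1%N).
Proof.
move=> n3 D P N sP /size0nil ->.
have [d sd dP] := @realizable_0n n n3 D [::] P erefl sP.
exists d; first by rewrite sd addn0.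
move=> e; have [inj_d dE] := dP e; split=> [/inj_d[]//|x]; rewrite addn0 => xE.
have [x1 <-] := dE x xE; rewrite x1 !addn0; split=> //.
by rewrite /weight_form addn0 addr0.
Qed.

Lemma realizable_mixed p q : (0 < p)%N -> (0 < q)%N -> (3 <= p + q)%N ->
  realizable p q (atilde_mixed p q).
Proof.
have R := atilde_mixed_rules.
move=> p0 q0 pq3.
(* Swapping clears the last bit, shifting lowers |p - q| by enough to outweigh that bit, and the
   hyperbolic step lowers p + q. *)
have [m] := ubnP ((p + q) * 2 + (p - q + (q - p)) * 2 + (q < p))%N.
elim: m p q p0 q0 pq3 => // m IH p q p0 q0 pq3 lem.
have [qp|pq] := ltnP q p.
  have qp3 : (3 <= q + p)%N by rewrite addnC.
  apply: (@realizable_ext _ _ (atilde_mixed q p)) => [x|].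
    by rewrite (mixed_sym R).
  by apply: realizable_swap => //; apply: IH; lia.
have [q4|q4] := ltnP (p + 4) q.
  have qE : q = (q - 4 + 4)%N by lia.
  have q40 : (0 < q - 4)%N by lia.
  rewrite qE.
  apply: (@realizable_ext _ _ (atilde_mixed (p + 4) (q - 4))) => [x|].
    by rewrite (mixed_shift R).
  by apply: realizable_shift => //; apply: IH; lia.
have step : (3 <= p)%N -> (3 <= p - 2 + (q - 2))%N ->
    (p - 2, q - 2)%N <> (1, 4)%N -> realizable p q (atilde_mixed p q).
  move=> p3 n3 n14.
  have [p20 q20] : (0 < p - 2)%N /\ (0 < q - 2)%N by lia.
  have n41 : (p - 2, q - 2)%N <> (4, 1)%N by case; lia.
  have pE : p = (p - 2).+2 by lia.
  have qE : q = (q - 2).+2 by lia.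
  have := mixed_step R _ p20 q20 n3 n14 n41; rewrite !addn2 -pE -qE => stepE.
  have : realizable (p - 2) (q - 2) (atilde_mixed (p - 2) (q - 2)).
    by apply: IH; lia.
  move/(realizable_hyperbolic q20); rewrite -pE -qE.
  by apply: realizable_ext => x; rewrite stepE /= addrA !addn2.
(* Now p <= q <= p + 4. For p = 3 the step fails only at q = 3 and q = 6, which would lead to (1, 1)
   and (1, 4); for p > 3 it always applies. *)
case: p p0 q0 pq3 pq q4 {IH lem} step => [//|[|[|[|p]]]] _.
- case: q => [|[|[|[|[|[|q]]]]]]; try by []; move=> _ _ _ _ _.
  + exact: realizable_at12.
  + exact: realizable_at13.
  + exact: realizable_at14.
  + exact: realizable_at15.
- case: q => [|[|[|[|[|[|[|q]]]]]]]; try by []; move=> _ _ _ _ _.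
  + exact: realizable_at22.
  + exact: realizable_at23.
  + exact: realizable_at24.
  + exact: realizable_at25.
  + exact: realizable_at26.
- case: q => [|[|[|[|[|[|[|[|q]]]]]]]]; try by []; move=> _ _ _ _ step;
    try by apply: step.
  + exact: realizable_at33.
  + exact: realizable_at36.
- by move=> q0 pq3 pq q4 step; apply: step; [|lia|case; lia].
Qed.

Lemma realizable_atilde p q : (3 <= p + q)%N -> realizable p q (atilde_val p q).
Proof.
rewrite /atilde_val; case: p => [|p]; first exact: realizable_0n.
case: q => [|q]; last exact: realizable_mixed.
by rewrite addn0; exact: realizable_n0.
Qed.

Theorem theorem3 (p q : nat) (hpq : (3 <= p + q)%N) :
  cubic_equiv (alpha p q) (atilde p q).
Proof.
(* The coordinate forms, as row vectors, are the old coordinates; the realized [d] will be the rows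
   of [G]. *)
pose P := [seq delta_mx 0 (lshift q i) : 'rV['F_2]_(p + q) | i <- enum 'I_p].
pose N := [seq delta_mx 0 (rshift p i) : 'rV['F_2]_(p + q) | i <- enum 'I_q].
have sP : size P = p by rewrite size_map size_enum_ord.
have sN : size N = q by rewrite size_map size_enum_ord.
have [d sd dP] := @realizable_atilde p q hpq _ P N sP sN.
pose G := \matrix_(i < p + q) d`_i.
have GE v i : (G *m v) i 0 = eval_row v d`_i.
  by rewrite /eval_row !mxE; apply: eq_bigr => j _; rewrite mxE.
have wtP v : wt (eval_row v) P = weight [seq v (lshift q i) 0 | i <- enum 'I_p].
  rewrite /wt -map_comp; congr weight.
  by apply: eq_map => i /=; rewrite eval_row_delta.
have wtN v : wt (eval_row v) N = weight [seq v (rshift p i) 0 | i <- enum 'I_q].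
  rewrite /wt -map_comp; congr weight.
  by apply: eq_map => i /=; rewrite eval_row_delta.
exists G => [|v].
  (* At a vector in the kernel of [G] all of [d] vanishes, hence so do both weights, that is, every
     coordinate. *)
  rewrite -unitmx_tr -row_free_unit; apply: inj_row_free => u uG.
  have {}uG : G *m u^T = 0 by rewrite -[G]trmxK -trmx_mul uG trmx0.
  have [inj_d _] := dP (eval_row u^T); have [] := inj_d.
    apply/eqP; rewrite weight_eq0 all_map; apply/(all_nthP 0) => i.
    by rewrite sd => lti; rewrite /= -[i]/(val (Ordinal lti)) -GE uG mxE.
  move=> /eqP; rewrite wtP weight_eq0 all_map => /allP P0.
  move=> /eqP; rewrite wtN weight_eq0 all_map => /allP N0.
  apply/trmx_inj/matrixP => i j; rewrite trmx0 [RHS]mxE ord1.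
  rewrite -[i]splitK; case: (split i) => k; apply/eqP.
    by apply: P0; rewrite mem_enum.
  by apply: N0; rewrite mem_enum.
have [_ dE] := dP (eval_row v).
have [i lti|_] := dE (var (G *m v)).
  by rewrite -[i]/(val (Ordinal lti)) varS GE.
by rewrite wtP wtN /= /atilde_fun alpha_funE.
Qed.
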